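(* Let $Q\subset M$ be compact and equal to the closure of its interior $W:=\mathrm{int}\,Q$ (nonvoid), and consider a control system $x_{k+1}=f(x_k,u_k)$ satisfying the accessibility condition $$\mathrm{int}\,\mathbf R^W(x)\ne\emptyset\ \text{ and }\ \mathrm{int}\,\mathbf C^W(x)\ne\emptyset\quad\text{for all }x\in W.$$ (i) Let $x\in Q$ and assume that there exists a compact set $F\subset W$ such that for all $y\in\mathbf R^W(x)$ one has $\mathrm{cl}\,\mathbf R^W(y)\cap F\ne\emptyset$. Then there exists an invariant $W$-control set $D\subset\mathrm{cl}_W\mathbf R^W(x)$. (ii) If there is a compact set $F\subset W$ such that $\mathrm{cl}\,\mathbf R^W(x)\cap F\ne\emptyset$ for all $x\in Q$, then for every $x\in Q$ there is an invariant $W$-control set $D$ with $D\subset\mathrm{cl}\,\mathbf R^W(x)$, and there are only finitely many invariant $W$-control sets $D_1,\ldots,D_\ell$. (iii) Conversely, suppose that for every $x\in Q$ there is an invariant $W$-control set $D$ with $D\subset\mathrm{cl}\,\mathbf R^W(x)$, that there are only finitely many invariant $W$-control sets $D_1,\ldots,D_\ell$, and that they all have nonvoid transitivity set. Then there is a compact set $F\subset W$ such that $\mathbf R^W(x)\cap F\ne\emptyset$ for all $x\in Q$.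
   Context: Setting. $\mathbb N=\{0,1,2,\ldots\}$. $M$ and $\Omega$ are metric spaces, $f:M\times\Omega\to M$ is continuous, and the control system is $x_{k+1}=f(x_k,u_k)$, $k\in\mathbb N$, with controls $u=(u_k)\in\mathcal U=\Omega^{\mathbb N}$; $\varphi(k,x,u)$ denotes the solution at time $k$ with $\varphi(0,x,u)=x$. Let $W\subset M$ be open and nonvoid; $\mathrm{cl}$ is closure in $M$ and $\mathrm{cl}_W$ is closure relative to $W$. For $k\ge1$ write $\varphi_W(k,x,u)=\varphi(k,x,u)$ if $\varphi(i,x,u)\in W$ for $i=1,\ldots,k$ (undefined otherwise). For $x\in M$, $$\mathbf R^W(x)=\{y\in W:\exists k\ge1\,\exists u\in\mathcal U: y=\varphi_W(k,x,u)\},\quad \mathbf C^W(x)=\{y\in W:\exists u\in\mathcal U\,\exists k\ge1:\varphi_W(k,y,u)=x\}.$$ A nonvoid subset $D\subset W$ is a $W$-control set if (a) $D\subset\mathrm{cl}_W\mathbf R^W(x)$ for all $x\in D$, (b) for every $x\in D$ there is $u\in\mathcal U$ with $\varphi_W(k,x,u)\in D$ for all $k\in\mathbb N$, and (c) $D$ is maximal with properties (a) and (b). It is an invariant $W$-control set if $\mathbf R^W(x)\subset\mathrm{cl}_WD$ for all $x\in D$. The transitivity set of $D$ is $D_0=\{x\in D: x\in\mathrm{int}\,\mathbf C^W(x)\}$.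
   Formalization: Part (i) additionally assumes that R^W(x) is nonempty; without it (i) fails, e.g. Q=[0,1], f(x,u)=ux, Ω=[1/2,2], x=0, where R^W(0) is empty and no nonvoid D lies in its closure. For x in W this follows from accessibility. *)

(* Defs.v *)
From HB Require Import structures.
From mathcomp Require Import all_boot all_order all_algebra.
From mathcomp Require Import all_classical all_reals all_analysis.

Set Implicit Arguments.
Unset Strict Implicit.
Unset Printing Implicit Defensive.

Local Open Scope classical_set_scope.

Fixpoint phi (M Omega : Type) (f : M * Omega -> M)
    (k : nat) (x : M) (u : nat -> Omega) : M :=
  if k is j.+1 then f (phi f j x u, u j) else x.

(* Graph of the partial map phi_W: [phiW f W k x u y] reads
   "phi_W(k, x, u) is defined and equals y". For k = 0 there is no
   constraint and phi_W(0, x, u) = x; x itself need not lie in W. *)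
Definition phiW (M Omega : Type) (f : M * Omega -> M) (W : set M)
    (k : nat) (x : M) (u : nat -> Omega) (y : M) : Prop :=
  (forall i, (1 <= i <= k)%N -> W (phi f i x u)) /\ y = phi f k x u.

Definition reachW (M Omega : Type) (f : M * Omega -> M) (W : set M)
    (x : M) : set M :=
  [set y | W y /\ exists k u, (1 <= k)%N /\ phiW f W k x u y].

Definition ctrlW (M Omega : Type) (f : M * Omega -> M) (W : set M)
    (x : M) : set M :=
  [set y | W y /\ exists u k, (1 <= k)%N /\ phiW f W k y u x].

(* Closure relative to W; only applied to subsets A of W, where it agrees with
   the closure in [subspace W] (see [closure_subspaceW]). *)
Definition clW (M : topologicalType) (W A : set M) : set M :=
  closure A `&` W.

Definition approx_controllableW (M : topologicalType) (Omega : Type)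
    (f : M * Omega -> M) (W D : set M) : Prop :=
  forall x, D x -> D `<=` clW W (reachW f W x).

Definition viableW (M Omega : Type) (f : M * Omega -> M) (W D : set M) : Prop :=
  forall x, D x -> exists u : nat -> Omega,
    forall k, exists y, phiW f W k x u y /\ D y.

Definition control_setW (M : topologicalType) (Omega : Type)
    (f : M * Omega -> M) (W D : set M) : Prop :=
  [/\ D !=set0, D `<=` W, approx_controllableW f W D, viableW f W D &
      forall D' : set M, D' `<=` W -> approx_controllableW f W D' ->
        viableW f W D' -> D `<=` D' -> D' = D].

Definition invariant_control_setW (M : topologicalType) (Omega : Type)
    (f : M * Omega -> M) (W D : set M) : Prop :=
  control_setW f W D /\ forall x, D x -> reachW f W x `<=` clW W D.

Definition transitivity_setW (M : topologicalType) (Omega : Type)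
    (f : M * Omega -> M) (W D : set M) : set M :=
  [set x | D x /\ (interior (ctrlW f W x)) x].

Definition accessibleW (M : topologicalType) (Omega : Type)
    (f : M * Omega -> M) (W : set M) : Prop :=
  forall x, W x ->
    interior (reachW f W x) !=set0 /\ interior (ctrlW f W x) !=set0.

(* Main.v *)
Require Import Defs.
From HB Require Import structures.
From mathcomp Require Import all_boot all_order all_algebra.
From mathcomp Require Import all_classical all_reals all_analysis.

Set Implicit Arguments.
Unset Strict Implicit.
Unset Printing Implicit Defensive.

Local Open Scope classical_set_scope.

(** Write R(x) for [reachW f W x] and C(x) for [ctrlW f W x].  Because W is open
and each f(., c) is continuous, reachability survives small perturbations of
the initial point ([near_reachW]).  Together with concatenation of controls
this shows that cl R(x) contains cl R(y) for every y in cl R(x)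
([reachW_closureS]).  Compare points by inclusion of the sets cl R(x): the
invariant W-control sets are the sets cl_W R(z) with z minimal in W.

Existence.  Consider the points z of F in cl R(x), in this preorder.  Along a
chain of them the closed sets cl R(z), each of which meets the compact F, have
a common point in F, and this point is a lower bound; hence Zorn's lemma gives
a minimal z ([exists_minimal_reach]).  By minimality all w in cl_W R(z) have the same
cl R(w), which makes cl_W R(z) an invariant W-control set
([minimal_reach_invariant_control_set]).

Finiteness.  An invariant W-control set equals cl_W R(x) for each of its points
x ([invariant_control_setE]); in particular two of them that meet are equal.
Given p in F, let D be an invariant W-control set in cl R(p).  It has interior
points, so R(p) meets D in such a point, and then R(y) meets D for every y near
p.  No other invariant W-control set can therefore come near p
([near_invariant_control_set_unique]), and compactness of F leaves room for
finitely many only.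

For the converse, F consists of one transitivity point from each D_i: if
cl R(x) contains D_i, then R(x) meets the neighbourhood int C(x_i) of the
chosen point x_i, so x_i is reached exactly ([reachW_transitivity_point]). *)

(** * Compactness arguments *)

Lemma compact_chain_bigcap (T : topologicalType) (I : Type) (K : set T)
    (A : set I) (G : I -> set T) :
  compact K -> A !=set0 -> (forall i, A i -> closed (G i)) ->
  (forall i, A i -> G i `&` K !=set0) ->
  total_on A (fun i j => G i `<=` G j) ->
  exists2 p, K p & forall i, A i -> G i p.
Proof.
move=> cK A0 clG GK tot.
pose B i := G i `&` K.
have FB : Filter (filter_from A B).
  apply: filter_from_filter => [//|i j Ai Aj].
  case: (tot i j Ai Aj) => [sij|sji].
    by exists i => // z [Gz Kz]; split; split => //; exact: sij.
  by exists j => // z [Gz Kz]; split; split => //; exact: sji.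
have PFB : ProperFilter (filter_from A B) by exact: filter_from_proper.
have [i0 Ai0] := A0.
have [|p [Kp clp]] := cK _ PFB; first by exists i0 => // z [].
exists p => // i Ai; apply: clG => // U Up.
have [|z [[Gz _] Uz]] := clp (B i) U _ Up; first by exists i.
by exists z.
Qed.

(** If [S] were infinite, the points of [K] that lie in members outside a given
finite subfamily would form a proper filter base. Near a cluster point of it,
[D0] being put in the finite subfamily, there would be a second member. *)
Lemma compact_locally_unique_finite (T : topologicalType) (K : set T)
    (S : set (set T)) :
  compact K -> (forall D, S D -> D `&` K !=set0) ->
  (forall p, K p -> exists D0 : set T,
     \forall y \near p, forall D, S D -> D y -> D = D0) ->
  finite_set S.
Proof.
move=> cK SK loc; apply: contrapT => infS.
pose B (A : set (set T)) := [set y | K y /\ exists D, [/\ S D, ~ A D & D y]].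
have FB : Filter (filter_from finite_set B).
  apply: filter_from_filter => [|A A' fA fA']; first by exists set0.
  exists (A `|` A'); first by rewrite finite_setU.
  by move=> y [Ky [D [SD nD Dy]]]; split; split => //; exists D; split => // AD;
    apply: nD; [left|right].
have PFB : ProperFilter (filter_from finite_set B).
  apply: filter_from_proper => A fA; apply: contrapT => BA0.
  apply: infS; apply: sub_finite_set fA => D SD; apply: contrapT => nAD.
  by have [y [Dy Ky]] := SK D SD; apply: BA0; exists y; split => //; exists D.
have [|p [Kp clp]] := cK _ PFB; first by exists set0 => // y [].
have [D0 nearD0] := loc p Kp.
have [|y [[_ [D [SD nD Dy]]] uniq]] := clp (B [set D0]) _ _ nearD0.
  by exists [set D0] => //; exact: finite_set1.
by apply: nD; exact: uniq.
Qed.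

(** * Trajectories and reachable sets *)

Section reachable_sets.
Variables (M : topologicalType) (Omega : Type) (f : M * Omega -> M).
Variable W : set M.
Implicit Types (x y z w : M) (u v : nat -> Omega) (D F : set M).

Lemma eq_phi x u v k : (forall i, (i < k)%N -> u i = v i) ->
  phi f k x u = phi f k x v.
Proof.
elim: k => [//|k IH] uv /=.
by rewrite uv // IH // => i ik; apply: uv; exact: ltnW.
Qed.

Definition catu k u v : nat -> Omega :=
  fun i => if (i < k)%N then u i else v (i - k)%N.

Lemma phi_catu_le k x u v i : (i <= k)%N ->
  phi f i x (catu k u v) = phi f i x u.
Proof. by move=> ik; apply: eq_phi => j ji; rewrite /catu (leq_trans ji ik). Qed.

Lemma phi_catu k x u v j :
  phi f (k + j) x (catu k u v) = phi f j (phi f k x u) v.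
Proof.
elim: j => [|j IH]; first by rewrite addn0 phi_catu_le.
by rewrite addnS /= IH /catu ltnNge leq_addr /= addKn.
Qed.

Lemma reachW_sub x : reachW f W x `<=` W.
Proof. by move=> y []. Qed.

Lemma reachW_trans x y z : reachW f W x y -> reachW f W y z -> reachW f W x z.
Proof.
move=> [_ [k [u [k1 [uW ->]]]]] [Wz [l [v [l1 [vW zE]]]]]; split => //.
exists (k + l)%N, (catu k u v); split; first by rewrite addn_gt0 k1.
split; last by rewrite phi_catu.
move=> i /andP[i1 ikl]; have [ik|ki] := leqP i k.
  by rewrite phi_catu_le //; apply: uW; rewrite i1.
rewrite -(subnKC (ltnW ki)) phi_catu; apply: vW.
by rewrite subn_gt0 ki leq_subLR.
Qed.

Lemma reachW_step x : reachW f W x !=set0 -> exists c, reachW f W x (f (x, c)).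
Proof.
move=> [y [_ [k [u [k1 [uW _]]]]]]; exists (u 0%N).
have W1 : W (f (x, u 0%N)) by apply: (uW 1%N).
split => //; exists 1%N, u; split => //; split => // i.
by case: i => [|[|i]].
Qed.

Lemma ctrlW_reachW x y : W x -> ctrlW f W x y -> reachW f W y x.
Proof. by move=> Wx [_ [u [k [k1 uk]]]]; split => //; exists k, u. Qed.

(** Iterating a choice of one-step controls gives a single control for all
times. *)
Lemma step_viableW D : D `<=` W -> (forall w, D w -> exists c, D (f (w, c))) ->
  viableW f W D.
Proof.
move=> DW step x Dx; have [c0 _] := step x Dx.
have /choice[g gD] : forall w, exists c, D w -> D (f (w, c)).
  move=> w; have [Dw|nDw] := pselect (D w); last by exists c0.
  by have [c Dc] := step w Dw; exists c.
pose xs n := iter n (fun w => f (w, g w)) x.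
have xsD n : D (xs n) by elim: n => [//|n IH]; exact: gD.
have phiE n : phi f n x (fun i => g (xs i)) = xs n by elim: n => //= n ->.
exists (fun n => g (xs n)) => k; exists (xs k); split => //.
by split => // i _; rewrite phiE; exact/DW/xsD.
Qed.

Hypothesis oW : open W.
Hypothesis hf : forall c, continuous (fun x => f (x, c)).

Lemma phi_continuous k u : continuous (fun x => phi f k x u).
Proof.
elim: k => [|k IH] x /=; first exact: cvg_id.
by apply: (@continuous_comp _ _ _ (fun x => phi f k x u)
  (fun y => f (y, u k))); [exact: IH|exact: hf].
Qed.

Lemma near_trajectory k x u :
  (forall i, (1 <= i <= k)%N -> W (phi f i x u)) ->
  \forall x' \near x, forall i, (1 <= i <= k)%N -> W (phi f i x' u).
Proof.
elim: k => [|k IH] uW; first by apply: filterE => x' [|i].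
have nearIH : \forall x' \near x,
    forall i, (1 <= i <= k)%N -> W (phi f i x' u).
  by apply: IH => i /andP[i1 ik]; apply: uW; rewrite i1 leqW.
have nearS : \forall x' \near x, W (phi f k.+1 x' u).
  apply: (@phi_continuous k.+1 u x); apply: open_nbhs_nbhs.
  by split => //; apply: uW; rewrite leqnn.
apply: filterS2 nearIH nearS => x' Wi Wk i /andP[i1].
by rewrite leq_eqVlt => /predU1P[->//|ik]; apply: Wi; rewrite i1.
Qed.

(** Lower semicontinuity of the reachable set: the same control still works
for nearby initial points. *)
Lemma near_reachW x z (V : set M) : reachW f W x z -> nbhs z V ->
  \forall x' \near x, reachW f W x' `&` V !=set0.
Proof.
move=> [_ [k [u [k1 [uW zE]]]]] Vz; rewrite zE in Vz.
have nearV := @phi_continuous k u x _ Vz.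
apply: filterS2 (near_trajectory uW) nearV => x' Wi Vx'.
exists (phi f k x' u); split => //; split; first by apply: Wi; rewrite k1 leqnn.
by exists k, u.
Qed.

Lemma reachW_closureS x y : closure (reachW f W x) y ->
  closure (reachW f W y) `<=` closure (reachW f W x).
Proof.
move=> xy; rewrite [X in _ `<=` X](closure_id _).1; last exact: closed_closure.
apply: closureS => z yz V Vz.
have [y' [xy' [v [y'v Vv]]]] := xy _ (near_reachW yz Vz).
by exists v; split => //; exact: reachW_trans xy' y'v.
Qed.

Lemma reachW_clW x w : clW W (reachW f W x) w ->
  reachW f W w `<=` clW W (reachW f W x).
Proof.
move=> [xw Ww] y wy; split; last exact: reachW_sub wy.
by apply: (reachW_closureS xw); exact: subset_closure.
Qed.

Hypothesis acc : forall x, W x -> interior (reachW f W x) !=set0.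

Lemma accessible_reachW_neq0 x : W x -> reachW f W x !=set0.
Proof. by move=> /acc[y /interior_subset]; exists y. Qed.

Lemma viableW_clW_reachW x : viableW f W (clW W (reachW f W x)).
Proof.
apply: step_viableW => [w []//|w xw].
have [c wc] := reachW_step (accessible_reachW_neq0 xw.2).
by exists c; exact: reachW_clW xw _ wc.
Qed.

(** Accessibility is what turns approximate into exact reachability: the open
set int R(z) lies in cl R(x), hence meets R(x). *)
Lemma closure_reachW_common x z : closure (reachW f W x) z -> W z ->
  exists2 y, reachW f W x y & reachW f W z y.
Proof.
move=> xz Wz; have [v zv] := acc Wz.
have /(reachW_closureS xz) xv : closure (reachW f W z) v.
  by apply: subset_closure; exact: interior_subset zv.
by have [y [xy zy]] := xv _ zv; exists y.
Qed.

(** * Invariant control sets *)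

(** The closure of [D] relative to [W] is again approximately controllable and
viable, so maximality makes [D] closed in [W]. *)
Lemma invariant_control_setE D x :
  invariant_control_setW f W D -> D x -> D = clW W (reachW f W x).
Proof.
move=> [[_ DW ac _ maxD] inv] Dx; set E := clW W (reachW f W x).
have DE : D `<=` E by move=> y Dy; exact: ac.
have EclD : E `<=` closure D.
  move=> w [xw _]; rewrite (closure_id (closure D)).1; last exact: closed_closure.
  by apply: closureS xw => y /(inv x Dx)[].
suff EE : E = D by [].
apply: maxD => //.
- by move=> w [].
- move=> w Ew y [xy Wy]; split => //.
  have [v wv] := acc Ew.2.
  have [d [Dd wd]] := EclD v (reachW_clW Ew (interior_subset wv)) _ wv.
  have dx : closure (reachW f W d) x by have [] := ac d Dd x Dx.
  apply: (@reachW_closureS w d); first by apply: subset_closure.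
  exact: reachW_closureS dx _ xy.
- exact: viableW_clW_reachW.
Qed.

Lemma invariant_control_set_eq D D' x :
  invariant_control_setW f W D -> invariant_control_setW f W D' ->
  D x -> D' x -> D = D'.
Proof.
move=> iD iD' Dx D'x.
by rewrite (invariant_control_setE iD Dx) (invariant_control_setE iD' D'x).
Qed.

Lemma minimal_reach_invariant_control_set z : W z ->
  (forall w, clW W (reachW f W z) w ->
     closure (reachW f W z) `<=` closure (reachW f W w)) ->
  invariant_control_setW f W (clW W (reachW f W z)).
Proof.
move=> Wz minz; set D := clW W (reachW f W z).
have RD w : D w -> reachW f W w `<=` D by exact: reachW_clW.
have DW : D `<=` W by move=> w [].
split; last first.
  by move=> w Dw y wy; split; [apply/subset_closure/(RD w)|exact: reachW_sub wy].
split => //.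
- have [y zy] := accessible_reachW_neq0 Wz; exists y; split.
    exact: subset_closure.
  exact: reachW_sub zy.
- by move=> w Dw y [zy Wy]; split => //; exact: minz zy.
- exact: viableW_clW_reachW.
- move=> D' D'W acD' _ DD'; apply/seteqP; split => // y D'y.
  (* approximate controllability of [D'] at a point [w] of [D] makes [D']
     consist of limits of points reachable from [w], and these stay in [D] *)
  have [w zw] := accessible_reachW_neq0 Wz.
  have Dw : D w by split; [exact: subset_closure|exact: reachW_sub zw].
  have [wy Wy] := acD' w (DD' w Dw) y D'y.
  by split => //; exact: reachW_closureS Dw.1 _ wy.
Qed.

(** Zorn's lemma on the points of [F] in cl R(x). The property that cl R(y)
meets [F] passes from the points of R(x) to those of cl_W R(x) by
[closure_reachW_common], so below every point of cl_W R(x) there is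
one of [F], and minimality among the points of [F] is minimality in
cl_W R(x). *)
Lemma exists_minimal_reach x F : compact F -> F `<=` W ->
  reachW f W x !=set0 ->
  (forall y, reachW f W x y -> closure (reachW f W y) `&` F !=set0) ->
  exists z, [/\ W z, closure (reachW f W x) z &
    forall w, clW W (reachW f W z) w ->
      closure (reachW f W z) `<=` closure (reachW f W w)].
Proof.
move=> cF FW [y0 xy0] meetF.
have clF w : closure (reachW f W x) w -> W w ->
    closure (reachW f W w) `&` F !=set0.
  move=> xw Ww; have [y xy wy] := closure_reachW_common xw Ww.
  have [p [yp Fp]] := meetF y xy; exists p; split => //.
  by apply: (@reachW_closureS w y) yp; exact: subset_closure.
pose P := {z | F z /\ closure (reachW f W x) z}.
pose G (z : P) := closure (reachW f W (sval z)).
have GF (z : P) : G z `&` F !=set0.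
  by case: (svalP z) => Fz xz; apply: clF => //; exact: FW.
have [p0 [y0p0 Fp0]] := meetF y0 xy0.
have xp0 : closure (reachW f W x) p0.
  by apply: (@reachW_closureS x y0) y0p0; exact: subset_closure.
pose z0 : P := exist _ p0 (conj Fp0 xp0).
have [||A totA|z maxz] := @ZL_preorder P z0 (fun r s => `[< G s `<=` G r >]).
- by move=> t; exact/asboolP.
- move=> r s t /asboolP rs /asboolP st; apply/asboolP.
  exact: subset_trans st rs.
- have [A0|nA0] := pselect (A !=set0); last first.
    by exists z0 => s As; case: nA0; exists s.
  have [|||p Fp Ap] := @compact_chain_bigcap _ _ F A G cF A0.
  + by move=> i _; exact: closed_closure.
  + by move=> i _; exact: GF.
  + by move=> i j Ai Aj; case: (totA i j Ai Aj) => /asboolP; [right|left].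
  have xp : closure (reachW f W x) p.
    have [s As] := A0.
    by apply: (reachW_closureS (svalP s).2); exact: Ap.
  exists (exist _ p (conj Fp xp)) => s As; apply/asboolP.
  by apply: reachW_closureS; exact: Ap.
have [Fz xz] := svalP z.
exists (sval z); split => //; first exact: FW.
move=> w [zw Ww].
have xw : closure (reachW f W x) w by exact: reachW_closureS xz _ zw.
have [p [wp Fp]] := clF w xw Ww.
have xp : closure (reachW f W x) p by exact: reachW_closureS xw _ wp.
pose zp : P := exist _ p (conj Fp xp).
have pw : G zp `<=` closure (reachW f W w) by exact: reachW_closureS.
have /maxz/asboolP zzp : `[< G zp `<=` G z >].
  by apply/asboolP; apply: subset_trans pw _; exact: reachW_closureS.
exact: subset_trans zzp pw.
Qed.

Lemma exists_invariant_control_set x F : compact F -> F `<=` W ->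
  reachW f W x !=set0 ->
  (forall y, reachW f W x y -> closure (reachW f W y) `&` F !=set0) ->
  exists D, invariant_control_setW f W D /\ D `<=` clW W (reachW f W x).
Proof.
move=> cF FW x0 meetF.
have [z [Wz xz minz]] := exists_minimal_reach cF FW x0 meetF.
exists (clW W (reachW f W z)); split.
  exact: minimal_reach_invariant_control_set.
by move=> w [zw Ww]; split => //; exact: reachW_closureS xz _ zw.
Qed.

(** Points near [p] can be steered into [D], which has interior points by
accessibility; an invariant control set that contains such a point meets
[D]. *)
Lemma near_invariant_control_set_unique p D :
  invariant_control_setW f W D -> D `<=` closure (reachW f W p) ->
  \forall y \near p, forall D', invariant_control_setW f W D' -> D' y -> D' = D.
Proof.
move=> iD Dp; have [[[d Dd] DW _ _ _] inv] := iD.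
have RD D' y : invariant_control_setW f W D' -> D' y -> reachW f W y `<=` D'.
  move=> iD' D'y v yv; rewrite (invariant_control_setE iD' D'y).
  by split; [exact: subset_closure|exact: reachW_sub yv].
have [v dv] := acc (DW d Dd).
have vD : nbhs v D by apply: filterS dv; exact: RD iD Dd.
have Dv : D v by exact: nbhs_singleton vD.
have [q [pq qD]] := Dp v Dv _ (nbhs_interior vD).
apply: filterS (near_reachW pq qD) => y [w [yw Dw]] D' iD' D'y.
exact: (invariant_control_set_eq iD' iD (RD D' y iD' D'y w yw) Dw).
Qed.

Lemma finite_invariant_control_sets F : compact F -> F `<=` W ->
  (forall x, W x -> closure (reachW f W x) `&` F !=set0) ->
  finite_set [set D | invariant_control_setW f W D].
Proof.
move=> cF FW meetF; apply: (compact_locally_unique_finite cF).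
  move=> D iD; have [[[x Dx] DW _ _ _] _] := iD.
  have [p [xp Fp]] := meetF x (DW x Dx); exists p; split => //.
  by rewrite (invariant_control_setE iD Dx); split => //; exact: FW.
move=> p Fp; have Wp := FW p Fp.
have [|D [iD Dp]] := exists_invariant_control_set cF FW
  (accessible_reachW_neq0 Wp).
  by move=> y /reachW_sub; exact: meetF.
exists D; apply: near_invariant_control_set_unique iD _.
by move=> y /Dp[].
Qed.

End reachable_sets.

Lemma reachW_transitivity_point (M : topologicalType) (Omega : Type)
    (f : M * Omega -> M) (W D : set M) (x d : M) :
  D `<=` W -> D `<=` closure (reachW f W x) ->
  transitivity_setW f W D d -> reachW f W x d.
Proof.
move=> DW Dx [Dd intC]; have [y [xy yC]] := Dx d Dd _ intC.
exact: reachW_trans xy (ctrlW_reachW (DW d Dd) yC).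
Qed.

Theorem theorem5p8 (R : realType) (M Omega : metricType R)
    (f : M * Omega -> M) (hf : continuous f)
    (Q W : set M) (hQ : compact Q) (hW : W = interior Q)
    (hQW : Q = closure W) (hW0 : W !=set0)
    (hacc : accessibleW f W) :
  (* (i); the nonemptiness premise only concerns x on the boundary of Q,
     since for x in W it follows from accessibility *)
  (forall x, Q x -> reachW f W x !=set0 ->
     (exists F : set M, [/\ compact F, F `<=` W &
        forall y, reachW f W x y ->
          closure (reachW f W y) `&` F !=set0]) ->
     exists D : set M, invariant_control_setW f W D /\
       D `<=` clW W (reachW f W x))
  /\
  (* (ii) *)
  ((exists F : set M, [/\ compact F, F `<=` W &
      forall x, Q x -> closure (reachW f W x) `&` F !=set0]) ->
   (forall x, Q x -> exists D : set M, invariant_control_setW f W D /\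
      D `<=` closure (reachW f W x)) /\
   finite_set [set D : set M | invariant_control_setW f W D])
  /\
  (* (iii) *)
  ((forall x, Q x -> exists D : set M, invariant_control_setW f W D /\
      D `<=` closure (reachW f W x)) ->
   finite_set [set D : set M | invariant_control_setW f W D] ->
   (forall D : set M, invariant_control_setW f W D ->
      transitivity_setW f W D !=set0) ->
   exists F : set M, [/\ compact F, F `<=` W &
     forall x, Q x -> reachW f W x `&` F !=set0]).
Proof.
have oW : open W by rewrite hW; exact: open_interior.
have WQ : W `<=` Q by rewrite hQW; exact: subset_closure.
have cf c : continuous (fun x => f (x, c)).
  move=> x; apply: (@continuous_comp _ _ _ (fun x => (x, c)) f); last exact: hf.
  by apply: cvg_pair; [exact: cvg_id|exact: cvg_cst].
have acc x : W x -> interior (reachW f W x) !=set0 by case/hacc.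
split; last split.
- move=> x _ x0 [F [cF FW meetF]].
  exact: (exists_invariant_control_set oW cf acc cF FW).
- move=> [F [cF FW meetF]]; split; last first.
    by apply: (finite_invariant_control_sets oW cf acc cF FW) => x /WQ/meetF.
  move=> x Qx.
  (* the trivial neighbourhood suffices: a nonvoid closure has a nonvoid set *)
  have x0 : reachW f W x !=set0.
    have [p [xp _]] := meetF x Qx.
    by have [y [xy _]] := xp setT filterT; exists y.
  have [|D [iD Dx]] := exists_invariant_control_set oW cf acc cF FW x0.
    by move=> y /reachW_sub/WQ; exact: meetF.
  by exists D; split => // y /Dx[].
- move=> exD finD trD.
  have /choice[d dD] : forall D, exists p,
      invariant_control_setW f W D -> transitivity_setW f W D p.
    move=> D; have [iD|niD] := pselect (invariant_control_setW f W D).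
      by have [p] := trD D iD; exists p.
    by have [w _] := hW0; exists w.
  exists [set d D | D in [set D | invariant_control_setW f W D]]; split.
  + exact/finite_compact/finite_image.
  + by move=> _ [D iD <-]; have [[_ DW _ _ _] _] := iD; exact/DW/(dD D iD).1.
  + move=> x Qx; have [D [iD Dx]] := exD x Qx.
    exists (d D); split; last by exists D.
    have [[_ DW _ _ _] _] := iD.
    exact: reachW_transitivity_point DW Dx (dD D iD).
Qed.
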